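(* There exist a finite ground set $V$, a nonnegative ordered-submodular function $f$ on finite sequences of elements of $V$, an integer $k \ge 1$, and an execution of the greedy algorithm (with some tie-breaking) whose output $A_k$ satisfies $$f(A_k) = \tfrac12\,\mathrm{OPT}(k) \quad\text{with}\quad \mathrm{OPT}(k) = \max\{f(S) : S \text{ a sequence of } k \text{ elements of } V\} > 0.$$ In particular the factor $\tfrac12$ in the approximation guarantee of the greedy algorithm for nonnegative ordered-submodular maximization cannot be improved.
   Context: For sequences $A, B$, $A\|B$ denotes concatenation and $A\|s$ denotes $A$ with element $s$ appended; $\emptyset$ is the empty sequence. A function $f$ on finite sequences of elements of $V$ is ordered-submodular if for all sequences $A$, $B$ and all elements $s, \bar s \in V$: $f(A\|s) - f(A) \ge f(A\|s\|B) - f(A\|\bar s\|B)$. The greedy algorithm: $A_0 = \emptyset$; for $\ell = 1,\dots,k$, $A_\ell = A_{\ell-1}\|a$ where $a \in V$ maximizes $f(A_{\ell-1}\|a)$, ties broken arbitrarily. *)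

(* Defs.v *)
From mathcomp Require Import all_boot all_order all_algebra.
From mathcomp Require Import reals.
Set Implicit Arguments.
Unset Strict Implicit.
Unset Printing Implicit Defensive.
Import Order.TTheory GRing.Theory Num.Theory.
Local Open Scope ring_scope.

(* Objective functions [f : seq V -> R] are defined on all finite sequences,
   repetitions allowed; A||B is [A ++ B] and A||s is [rcons A s]. *)

Definition nonnegative (R : realType) (V : finType) (f : seq V -> R) : Prop :=
  forall S : seq V, 0 <= f S.

Definition ordered_submodular (R : realType) (V : finType)
    (f : seq V -> R) : Prop :=
  forall (A B : seq V) (s s' : V),
    f (rcons A s) - f A >= f (rcons A s ++ B) - f (rcons A s' ++ B).

(* [greedy f k A]: some execution of the greedy algorithm has A_k = A. It is a
   relation because each step may pick any of the maximizers. *)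
Inductive greedy (R : realType) (V : finType) (f : seq V -> R) :
    nat -> seq V -> Prop :=
| greedy_nil : greedy f 0 [::]
| greedy_rcons (l : nat) (A : seq V) (a : V) :
    greedy f l A ->
    (forall b : V, f (rcons A b) <= f (rcons A a)) ->
    greedy f l.+1 (rcons A a).

Definition is_OPT (R : realType) (V : finType) (f : seq V -> R) (k : nat)
    (m : R) : Prop :=
  (exists2 S : seq V, size S = k & f S = m) /\
  (forall S : seq V, size S = k -> f S <= m).

Definition greedy_guarantee (R : realType) (c : R) : Prop :=
  forall (V : finType) (f : seq V -> R) (k : nat) (A : seq V) (OPT : R),
    nonnegative f -> ordered_submodular f -> (1 <= k)%N ->
    greedy f k A -> is_OPT f k OPT ->
    f A >= c * OPT.

(* Main.v *)
(* With two elements a and b, a sequence is worth 1 as soon as it is nonempty,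
   and 1 more if it starts with b and contains a. Singletons all have value 1,
   so greedy may start with a and is then stuck at 1, while (b, a) has value 2. *)
Require Import Defs.
From mathcomp Require Import all_boot all_order all_algebra.
From mathcomp Require Import reals.
Set Implicit Arguments.
Unset Strict Implicit.
Unset Printing Implicit Defensive.
Import Order.TTheory GRing.Theory Num.Theory.
Local Open Scope ring_scope.

(* [false] and [true] stand for a and b. *)
Definition tight_value (S : seq bool) : nat :=
  (S != [::]) + (head false S && (false \in S)).

Lemma tight_value_le2 (S : seq bool) : (tight_value S <= 2)%N.
Proof. by rewrite /tight_value; case: (S != _); case: (_ && _). Qed.

(** For [A] empty, singletons are worth 1 and nonempty sequences 1 or 2, so at worst this reads 2 <=
    1 + 1. A nonempty [A] fixes the head: if it is a, all values are 1; if it is b, only the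
    indicator of containing a varies, which is monotone with diminishing returns. *)
Lemma tight_value_submodular (A B : seq bool) (s s' : bool) :
  (tight_value (rcons A s ++ B) + tight_value A <=
   tight_value (rcons A s) + tight_value (rcons A s' ++ B))%N.
Proof.
case: A => [|x A]; rewrite /tight_value /=.
  by case: s; case: s'; rewrite /= ?inE; case: (false \in B).
rewrite !inE !mem_cat !mem_rcons !inE.
by case: x; case: s; case: s' => /=; case: (false \in A); case: (false \in B).
Qed.

Section TightInstance.
Variable R : realType.

Let f (S : seq bool) : R := (tight_value S)%:R.

Lemma tight_nonnegative : nonnegative f.
Proof. by move=> S; apply: ler0n. Qed.

Lemma tight_ordered_submodular : ordered_submodular f.
Proof.
(* Clearing both subtractions leaves sums of casts, hence an inequality in [nat]. *)
move=> A B s s'; rewrite lerBrDr addrAC lerBlDr -!natrD ler_nat.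
exact: tight_value_submodular.
Qed.

(** Both steps are ties at value 1: first between the singletons, then between the two extensions of
    (a). *)
Lemma tight_greedy : greedy f 2 [:: false; false].
Proof.
apply: (@greedy_rcons _ _ f 1 [:: false]); last by case.
by apply: (@greedy_rcons _ _ f 0 [::]); [exact: greedy_nil | case].
Qed.

Lemma tight_OPT : is_OPT f 2 2.
Proof.
split; first by exists [:: true; false].
by move=> S _; rewrite ler_nat tight_value_le2.
Qed.

End TightInstance.

Theorem theorem2 (R : realType) :
  (exists (V : finType) (f : seq V -> R) (k : nat) (A : seq V) (OPT : R),
      [/\ nonnegative f, ordered_submodular f & (1 <= k)%N] /\
      [/\ greedy f k A, is_OPT f k OPT, 0 < OPT & f A = 2^-1 * OPT]) /\
  (forall c : R, 2^-1 < c -> ~ greedy_guarantee c).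
Proof.
have tight : exists (V : finType) (f : seq V -> R) (k : nat) (A : seq V)
    (OPT : R), [/\ nonnegative f, ordered_submodular f & (1 <= k)%N] /\
    [/\ greedy f k A, is_OPT f k OPT, 0 < OPT & f A = 2^-1 * OPT].
  exists bool, (fun S => (tight_value S)%:R), 2%N, [:: false; false], 2.
  split; split.
  - exact: tight_nonnegative.
  - exact: tight_ordered_submodular.
  - by [].
  - exact: tight_greedy.
  - exact: tight_OPT.
  - by rewrite ltr0n.
  - by rewrite mulVf // pnatr_eq0.
split=> // c c_gt guarantee.
(* On the tight instance the guarantee reads [c * OPT <= 2^-1 * OPT]; cancelling [OPT > 0]
   contradicts [2^-1 < c]. *)
have [V [f [k [A [OPT [[f_ge0 f_sub k_gt0] [grA optf OPT_gt0 fA]]]]]]] := tight.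
have := guarantee V f k A OPT f_ge0 f_sub k_gt0 grA optf.
by rewrite fA ler_pM2r // leNgt c_gt.
Qed.
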